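(* Let $1\le p<\infty$ and let $w=\{w_n\}_{n\in\mathbb{Z}}$ be a bounded sequence of positive real numbers such that the limits $\lim_{n\to+\infty}w_n=w_+$ and $\lim_{n\to\infty}w_{-n}=w_-$ exist. Let $T$ be either the bilateral weighted forward shift $F_w$ or the bilateral weighted backward shift $B_w$ on $\ell^p(\mathbb{Z})$. Then the following hold. (a) If $T$ is invertible, then $\sigma(T)=\{\lambda\in\mathbb{C}:\min\{w_-,w_+\}\le|\lambda|\le\max\{w_-,w_+\}\}$. (b) If $T$ is not invertible, then $\sigma(T)=\{\lambda\in\mathbb{C}:|\lambda|\le\max\{w_-,w_+\}\}$.
   Context: $\ell^p(\mathbb{Z})$ is the complex Banach space of $p$-summable families indexed by $\mathbb{Z}$. The bilateral weighted shifts with weights $w$ are the bounded operators $F_w(\{x_n\}_{n\in\mathbb{Z}})=\{w_{n-1}x_{n-1}\}_{n\in\mathbb{Z}}$ and $B_w(\{x_n\}_{n\in\mathbb{Z}})=\{w_{n+1}x_{n+1}\}_{n\in\mathbb{Z}}$. The spectrum $\sigma(T)$ is the set of $\lambda\in\mathbb{C}$ such that $T-\lambda I$ is not invertible in the algebra of bounded operators on $\ell^p(\mathbb{Z})$. *)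

(* Defs.v *)
From HB Require Import structures.
From mathcomp Require Import all_boot all_order all_algebra.
From mathcomp Require Import complex.
From mathcomp Require Import all_classical all_reals all_analysis.
From mathcomp Require Import ring.

Set Implicit Arguments.
Unset Strict Implicit.
Unset Printing Implicit Defensive.

Import Order.TTheory GRing.Theory Num.Theory.
Import numFieldNormedType.Exports.

Local Open Scope classical_set_scope.
Local Open Scope ring_scope.
Local Open Scope complex_scope.

Section bounded_operators.
Variables (K : numFieldType) (V : normedModType K).

Definition bounded_op (T : V -> V) : Prop :=
  exists M : K, forall x, `|T x| <= M * `|x|.

(* Invertibility in the algebra of bounded operators: the inverse is itself
   required to be a bounded linear map. *)
Definition invertible_op (T : V -> V) : Prop :=
  exists S : {linear V -> V}, [/\ bounded_op S, cancel S T & cancel T S].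

Definition spectrum (T : V -> V) : set K :=
  [set l | ~ invertible_op (T \- l \*: idfun)].

End bounded_operators.

Section esum_scale.
Context {R : realType} {I : choiceType}.
Implicit Types (a : I -> \bar R) (c : R).

Lemma esumZl_le a c : 0 <= c -> (forall i, 0 <= a i)%E ->
  (\esum_(i in [set: I]) (c%:E * a i) <= c%:E * \esum_(i in [set: I]) a i)%E.
Proof.
move=> c0 a0; apply: ge_ereal_sup => _ [X fX <-].
rewrite -ge0_mule_fsumr//; apply: lee_wpmul2l; first by rewrite lee_fin.
by apply: ereal_sup_ubound; exists X.
Qed.

Lemma esumZl a c : 0 <= c -> (forall i, 0 <= a i)%E ->
  (\esum_(i in [set: I]) (c%:E * a i) = c%:E * \esum_(i in [set: I]) a i)%E.
Proof.
rewrite le_eqVlt => /predU1P[<- a0|c0 a0].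
  by rewrite mul0e esum1// => i _; rewrite mul0e.
apply/eqP; rewrite eq_le esumZl_le ?(ltW c0)//=.
rewrite muleC -lee_pdivlMr// muleC.
have ca0 i : (0 <= c%:E * a i)%E by rewrite mule_ge0// lee_fin ltW.
have c'0 : 0 <= c^-1 by rewrite invr_ge0 ltW.
apply: le_trans (esumZl_le c'0 ca0).
by apply: le_esum => i _; rewrite muleA -EFinM mulVf ?mul1e// gt_eqF.
Qed.

End esum_scale.

Section lp_sum.
Context {R : realType} (p : R).
Implicit Types x y : int -> R[i].

(* [Normc.normc] is the R-valued modulus on R[i], whereas [`|_|] takes its
   values in the (real part of the) partially ordered field R[i] itself. *)
Definition lp_sum x : \bar R :=
  (\esum_(n in [set: int]) ((Normc.normc (x n)) `^ p)%:E)%E.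

Definition lp_norm x : R := (fine (lp_sum x)) `^ p^-1.

Lemma normc_ge0 (z : R[i]) : 0 <= Normc.normc z.
Proof. by case: z => a b; exact: sqrtr_ge0. Qed.

Lemma lp_sum_ge0 x : (0 <= lp_sum x)%E.
Proof. by apply: esum_ge0 => n _; rewrite lee_fin powR_ge0. Qed.

Lemma lp_norm_ge0 x : 0 <= lp_norm x.
Proof. exact: powR_ge0. Qed.

Lemma lp_sumZ c x : lp_sum (c *: x) = (((Normc.normc c) `^ p)%:E * lp_sum x)%E.
Proof.
rewrite /lp_sum -esumZl ?powR_ge0//; last by move=> i; rewrite lee_fin powR_ge0.
apply: eq_esum => n _.
by rewrite -EFinM -powRM ?normc_ge0// -Normc.normcM.
Qed.

Hypothesis p1 : 1 <= p.

Let p0 : 0 < p. Proof. exact: lt_le_trans ltr01 p1. Qed.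
Let pN0 : p != 0. Proof. by rewrite gt_eqF. Qed.

Lemma lp_norm_powR x : (lp_sum x < +oo)%E -> (lp_norm x `^ p)%:E = lp_sum x.
Proof.
move=> xoo; rewrite /lp_norm -powRrM mulVf// powRr1 ?fine_ge0 ?lp_sum_ge0//.
by rewrite fineK// ge0_fin_numE ?lp_sum_ge0.
Qed.

Lemma lp_norm_le x c : 0 <= c -> (lp_sum x <= (c `^ p)%:E)%E -> lp_norm x <= c.
Proof.
move=> c0 xc; have xoo : (lp_sum x < +oo)%E by exact: le_lt_trans xc (ltry _).
have -> : c = (c `^ p) `^ p^-1 by rewrite -powRrM mulfV// powRr1.
apply: ge0_ler_powR.
- by rewrite invr_ge0 ltW.
- by rewrite nnegrE fine_ge0// lp_sum_ge0.
- by rewrite nnegrE powR_ge0.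
- by rewrite -lee_fin fineK// ge0_fin_numE ?lp_sum_ge0.
Qed.

Lemma lp_norm0_eq0 x : (lp_sum x < +oo)%E -> lp_norm x = 0 -> x = 0.
Proof.
move=> xoo x0; have s0 : lp_sum x = 0%E by rewrite -lp_norm_powR// x0 powR0.
apply/funext => n; apply: Normc.eq0_normc; apply/eqP.
have : ((Normc.normc (x n) `^ p)%:E <= lp_sum x)%E.
  apply: esum_ge; exists [set n]; last by rewrite fsbig_set1.
  by split=> //; exact: finite_set1.
rewrite s0 lee_fin => xn0; have : Normc.normc (x n) `^ p == 0.
  by rewrite eq_le xn0 powR_ge0.
by rewrite powR_eq0 => /andP[].
Qed.

Lemma powR_convex_bound (a b u v : R) : 0 < a -> 0 < b -> 0 <= u -> 0 <= v ->
  (u + v) `^ p <= (a + b) `^ p *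
    (a / (a + b) * (u `^ p / a `^ p) + b / (a + b) * (v `^ p / b `^ p)).
Proof.
move=> a0 b0 u0 v0; have ab0 : 0 < a + b by exact: addr_gt0.
have t0 : 0 <= a / (a + b) by rewrite divr_ge0 ?ltW.
have t1 : a / (a + b) <= 1 by rewrite ler_pdivrMr// mul1r lerDl ltW.
have h := @convex_powR R p p1 (Itv01 t0 t1) (u / a) (v / b).
have {}h : (a / (a + b) * (u / a) + b / (a + b) * (v / b)) `^ p <=
    a / (a + b) * (u / a) `^ p + b / (a + b) * (v / b) `^ p.
  have -> : b / (a + b) = unstable.onem (a / (a + b)).
      by rewrite /unstable.onem; field; rewrite gt_eqF.
  by apply: h; rewrite inE/= in_itv/= andbT divr_ge0// ltW.
have E : u + v = (a + b) * (a / (a + b) * (u / a) + b / (a + b) * (v / b)).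
  by field; rewrite !gt_eqF.
have E0 : 0 <= a / (a + b) * (u / a) + b / (a + b) * (v / b).
  by rewrite addr_ge0// mulr_ge0// divr_ge0// ltW.
rewrite {1}E (powRM _ (ltW ab0) E0) ler_wpM2l ?powR_ge0//; apply: le_trans h _.
have V (z : R) : 0 < z -> z^-1 `^ p = (z `^ p)^-1.
  by move=> z0; rewrite -powR_inv1 ?ltW// powRAC powR_inv1 ?powR_ge0.
have [a'0 b'0] : 0 <= a^-1 /\ 0 <= b^-1 by rewrite !invr_ge0 !ltW.
by rewrite (powRM _ u0 a'0) (powRM _ v0 b'0) !V.
Qed.

Lemma lp_sumD_le x y (a b : R) : 0 < a -> 0 < b ->
  (lp_sum x <= (a `^ p)%:E)%E -> (lp_sum y <= (b `^ p)%:E)%E ->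
  (lp_sum (x + y)%R <= ((a + b) `^ p)%:E)%E.
Proof.
move=> a0 b0 xa yb; have ab0 : 0 < a + b by exact: addr_gt0.
pose ca := (a + b) `^ p * (a / (a + b) / a `^ p).
pose cb := (a + b) `^ p * (b / (a + b) / b `^ p).
have c0 z : 0 < z -> 0 <= (a + b) `^ p * (z / (a + b) / z `^ p).
  move=> z0; apply: mulr_ge0; first exact: powR_ge0.
  by apply: divr_ge0; [apply: divr_ge0; exact: ltW|exact: powR_ge0].
have [ca0 cb0] : 0 <= ca /\ 0 <= cb by split; exact: c0.
have pos z n : (0 <= (Normc.normc (z n : R[i]) `^ p)%:E)%E.
  by rewrite lee_fin powR_ge0.
apply: (@le_trans _ _ (ca%:E * lp_sum x + cb%:E * lp_sum y)%E).
  rewrite /lp_sum -!esumZl// -esumD; last 2 first.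
  - by move=> n _; rewrite mule_ge0// lee_fin.
  - by move=> n _; rewrite mule_ge0// lee_fin.
  apply: le_esum => n _; rewrite -!EFinM -EFinD lee_fin.
  apply: (@le_trans _ _ ((Normc.normc (x n) + Normc.normc (y n)) `^ p)).
    apply: ge0_ler_powR; rewrite ?nnegrE ?addr_ge0 ?normc_ge0 ?(ltW p0)//.
    exact: le_normcD.
  apply: le_trans (powR_convex_bound a0 b0 _ _) _; rewrite ?normc_ge0//.
  rewrite le_eqVlt; apply/orP; left; apply/eqP.
  by rewrite /ca /cb; ring.
apply: (@le_trans _ _ (ca%:E * (a `^ p)%:E + cb%:E * (b `^ p)%:E)%E).
  by apply: leeD; apply: lee_wpmul2l.
rewrite -!EFinM -EFinD lee_fin le_eqVlt; apply/orP; left; apply/eqP.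
rewrite /ca /cb; field.
by rewrite !gt_eqF ?powR_gt0.
Qed.

Lemma lp_sumD_lty x y : (lp_sum x < +oo)%E -> (lp_sum y < +oo)%E ->
  (lp_sum (x + y)%R < +oo)%E.
Proof.
have h z : (lp_sum z < +oo)%E -> (lp_sum z <= ((lp_norm z + 1) `^ p)%:E)%E.
  move=> zoo; rewrite -lp_norm_powR// lee_fin.
  by apply: ge0_ler_powR;
    rewrite ?nnegrE ?addr_ge0 ?lp_norm_ge0 ?lerDl ?(ltW p0).
move=> /h xoo /h yoo; apply: le_lt_trans (lp_sumD_le _ _ xoo yoo) (ltry _).
- by rewrite ltr_wpDl ?lp_norm_ge0.
- by rewrite ltr_wpDl ?lp_norm_ge0.
Qed.

Lemma lp_normD x y : (lp_sum x < +oo)%E -> (lp_sum y < +oo)%E ->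
  lp_norm (x + y) <= lp_norm x + lp_norm y.
Proof.
move=> xoo yoo.
have [/(lp_norm0_eq0 xoo) ->|x0] := eqVneq (lp_norm x) 0.
  by rewrite add0r lerDr lp_norm_ge0.
have [/(lp_norm0_eq0 yoo) ->|y0] := eqVneq (lp_norm y) 0.
  by rewrite addr0 lerDl lp_norm_ge0.
apply: lp_norm_le; first by rewrite addr_ge0 ?lp_norm_ge0.
apply: lp_sumD_le; last 2 first.
- by rewrite lp_norm_powR.
- by rewrite lp_norm_powR.
- by rewrite lt0r x0 lp_norm_ge0.
- by rewrite lt0r y0 lp_norm_ge0.
Qed.

Lemma lp_normZ c x : (lp_sum x < +oo)%E ->
  lp_norm (c *: x) = Normc.normc c * lp_norm x.
Proof.
move=> xoo; rewrite /lp_norm lp_sumZ -(lp_norm_powR xoo) -EFinM/=.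
rewrite powRM ?powR_ge0// -!powRrM !mulfV// !powRr1 ?normc_ge0//.
Qed.

Lemma lp_sum0 : lp_sum 0 = 0%E.
Proof. by apply: esum1 => n _; rewrite Normc.normc0 powR0. Qed.

End lp_sum.

Section lp_space.
Context {R : realType} {p : R}.

Definition lp_pred (p1 : 1 <= p) : {pred int -> R[i]} :=
  [pred x | (lp_sum p x < +oo)%E].

Variable p1 : 1 <= p.

(* The space l^p(Z) over the complex field, for 1 <= p < +oo. The proof [p1]
   is a parameter of the type so that the normed module structure, whose
   triangle inequality needs it, can be inferred. *)
Record lp := Lp { lp_val :> int -> R[i]; lp_valP : lp_val \in lp_pred p1 }.

HB.instance Definition _ := [isSub of lp for lp_val].
HB.instance Definition _ := [Choice of lp by <:].

Lemma lp_submod_closed : submod_closed (lp_pred p1).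
Proof.
split; first by rewrite inE lp_sum0.
move=> c x y; rewrite !inE => xoo yoo; apply: lp_sumD_lty => //.
by rewrite lp_sumZ lte_mul_pinfty// ?lee_fin ?powR_ge0.
Qed.

HB.instance Definition _ :=
  GRing.isSubmodClosed.Build _ _ (lp_pred p1) lp_submod_closed.
HB.instance Definition _ := [SubChoice_isSubLmodule of lp by <:].

Lemma lp_lty (x : lp) : (lp_sum p x < +oo)%E.
Proof. by have := lp_valP x; rewrite inE. Qed.

Let nm (x : lp) : R[i] := (lp_norm p x)%:C.

Let nmD (x y : lp) : nm (x + y) <= nm x + nm y.
Proof. by rewrite -rmorphD/= lecR lp_normD ?lp_lty. Qed.

Let nmZ (c : R[i]) (x : lp) : nm (c *: x) = `|c| * nm x.
Proof. by rewrite /nm [X in lp_norm p X]/= lp_normZ ?lp_lty// rmorphM. Qed.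

Let nm_eq0 (x : lp) : nm x = 0 -> x = 0.
Proof.
by move=> /complexI x0; apply: val_inj; apply: (lp_norm0_eq0 p1) => //; exact: lp_lty.
Qed.

HB.instance Definition _ := Lmodule_isNormed.Build R[i] lp nmD nmZ nm_eq0.

Lemma lp_normE (x : lp) : `|x| = (lp_norm p x)%:C.
Proof. by []. Qed.

End lp_space.

Section weighted_shifts.
Context {R : realType} {p : R} (p1 : 1 <= p).
Variables (w : int -> R) (wb : bounded_fun w).

Let weight_bound : exists2 M : R, 0 <= M & forall n, `|w n| <= M.
Proof.
have [M wM] := (@ex_bound _ _ _ w _ (globally_properfilter (I : [set: int] 0))).1 wb.
exists M; last by move=> n; exact: wM.
exact: le_trans (normr_ge0 (w 0)) (wM 0 I).
Qed.

Let lp_sum_shift (k : int) (x : int -> R[i]) (M : R) : 0 <= M ->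
  (forall n, `|w n| <= M) ->
  (lp_sum p (fun n => (w (n + k))%:C * x (n + k))%R <=
   (M `^ p)%:E * lp_sum p x)%E.
Proof.
move=> M0 wM.
rewrite /lp_sum [X in (_ * X)%E](@reindex_esum _ _ _ setT _ (fun n => n + k)).
  rewrite -esumZl ?powR_ge0//; last by move=> n; rewrite lee_fin powR_ge0.
  apply: le_esum => n _; rewrite -EFinM lee_fin Normc.normcM.
  rewrite powRM ?normc_ge0// ler_wpM2r ?powR_ge0//.
  apply: ge0_ler_powR; rewrite ?nnegrE ?normc_ge0//.
    exact: le_trans ler01 p1.
  by rewrite /Normc.normc /= expr0n addr0 sqrtr_sqr.
split=> //; first by move=> m n _ _ /addIr.
by move=> n _; exists (n - k) => //; rewrite subrK.
Qed.

(* Boundedness of the weights [wb] is only used to know that the shifted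
   family is again p-summable. *)
Definition forward_shift_fun (x : lp p1) : int -> R[i] :=
  fun n => (w (n - 1))%:C * x (n - 1).

Definition backward_shift_fun (x : lp p1) : int -> R[i] :=
  fun n => (w (n + 1))%:C * x (n + 1).

Let shift_subproof (k : int) (x : lp p1) :
  (fun n => (w (n + k))%:C * x (n + k)) \in lp_pred p1.
Proof.
have [M M0 wM] := weight_bound; rewrite inE.
apply: le_lt_trans (lp_sum_shift k x M0 wM) _.
by rewrite lte_mul_pinfty ?lee_fin ?powR_ge0// lp_lty.
Qed.

Lemma forward_shift_subproof (x : lp p1) : forward_shift_fun x \in lp_pred p1.
Proof. exact: (shift_subproof (- 1) x). Qed.

Lemma backward_shift_subproof (x : lp p1) : backward_shift_fun x \in lp_pred p1.
Proof. exact: shift_subproof. Qed.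

Definition forward_shift (x : lp p1) : lp p1 := Lp (forward_shift_subproof x).

Definition backward_shift (x : lp p1) : lp p1 := Lp (backward_shift_subproof x).

Lemma forward_shift_is_linear : linear forward_shift.
Proof.
move=> c x y; apply: val_inj; apply/funext => n /=.
rewrite /forward_shift_fun /=.
by rewrite [LHS]mulrDr; congr (_ + _); exact: mulrCA.
Qed.

Lemma backward_shift_is_linear : linear backward_shift.
Proof.
move=> c x y; apply: val_inj; apply/funext => n /=.
rewrite /backward_shift_fun /=.
by rewrite [LHS]mulrDr; congr (_ + _); exact: mulrCA.
Qed.

HB.instance Definition _ := GRing.isLinear.Build R[i] (lp p1) (lp p1) _
  forward_shift forward_shift_is_linear.
HB.instance Definition _ := GRing.isLinear.Build R[i] (lp p1) (lp p1) _
  backward_shift backward_shift_is_linear.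

Let shift_bounded (k : int) (x y : lp p1) (M : R) : 0 <= M ->
  (forall n, `|w n| <= M) ->
  (y : int -> R[i]) = (fun n => (w (n + k))%:C * x (n + k)) ->
  `|y| <= M%:C * `|x|.
Proof.
move=> M0 wM yE; rewrite !lp_normE -rmorphM lecR yE; apply: lp_norm_le => //.
  by rewrite mulr_ge0 ?lp_norm_ge0.
rewrite powRM ?lp_norm_ge0// EFinM lp_norm_powR ?lp_lty//.
exact: lp_sum_shift.
Qed.

Lemma forward_shift_bounded : bounded_op forward_shift.
Proof.
have [M M0 wM] := weight_bound; exists M%:C => x.
exact: (shift_bounded (k := - 1)).
Qed.

Lemma backward_shift_bounded : bounded_op backward_shift.
Proof.
have [M M0 wM] := weight_bound; exists M%:C => x.
exact: (shift_bounded (k := 1)).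
Qed.

End weighted_shifts.

(* Main.v *)
Require Import Defs.
From HB Require Import structures.
From mathcomp Require Import all_boot all_order all_algebra.
From mathcomp Require Import complex.
From mathcomp Require Import all_classical all_reals all_analysis.
From mathcomp Require Import ring lra zify.

(** For both shifts and every l, the operator T - l fails to be invertible
    exactly when min(w_-, w_+) <= |l| <= max(w_-, w_+).  Both assertions follow
    from this: taking l = 0, a non-invertible T forces the minimum to be 0.
    Reflecting indices exchanges B_w with the forward shift of weights
    w_(-n), so only forward shifts are studied.

    Three tools carry the argument.

    - Perturbation [invertible_op_perturbation]: an operator closer to an
      invertible T than the lower bound of T is invertible.  The equation is
      solved as a fixed point of a contraction, which rests on the
      completeness of l^p(Z); limits are built coordinatewise and the tail
      is estimated by a Fatou argument.

    - Finite change of weights [invertible_shift_finite_change]: two positive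
      weights that agree off a finite set give similar shifts.  The similarity
      is the diagonal operator with entries d satisfying
      u_n d_(n+1) = w_n d_n; these are bilateral products of the ratios
      w_n / u_n, hence bounded above and away from 0.

    - Clipping [invertible_shift_clip]: since w has limits at both ends, taking
      the minimum or the maximum with a constant on the correct side of the
      limit changes finitely many weights only.

    If |l| > max(w_-, w_+), clip the weights by r < |l|; then F - l is a small
    perturbation of the homothety - l.  If |l| < min(w_-, w_+), clip from below
    by r > |l|; then F - l is a small perturbation of the invertible operator F.

    In the closed annulus, suppose that F - l is invertible.  For l = 0 the
    lower bound of F bounds the weights from below, so that both limits are
    positive and 0 is not in the annulus.  For l <> 0,
    multiply the weights by 1 - e on one half of Z and by 1 + e on the other;
    for small e this is a small perturbation, and it moves the two limits
    strictly to opposite sides of |l|, even when |l| is on the boundary of the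
    annulus.  After clipping, the bilateral geometric product of u_n / l or of
    l / u_n decays exponentially in both directions.  In the first case it is
    an eigenvector; in the second it is a linear functional vanishing on the
    range of F - l, so that the range misses the basis vector e_0. *)

Set Implicit Arguments.
Unset Strict Implicit.
Unset Printing Implicit Defensive.

Import Order.TTheory GRing.Theory Num.Theory.
Import numFieldNormedType.Exports.

Local Open Scope classical_set_scope.
Local Open Scope ring_scope.
Local Open Scope complex_scope.

(** * Invertibility of operators *)

Section operators.
Context {K : numFieldType} {V : normedModType K}.
Implicit Types S T D : {linear V -> V}.

(** The inverse of a linear bijection is linear, and a lower bound for the
    operator is an upper bound for its inverse. *)
Lemma invertible_opP T : invertible_op T <->
  (exists2 c : K, 0 < c & forall x, c * `|x| <= `|T x|) /\
  (forall y, exists x, T x = y).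
Proof.
split=> [[S [[M SM] ST TS]]|[[c c0 cT] surjT]].
  split; last by move=> y; exists (S y).
  (* A bound M of the inverse may be 0 or, on the zero space, negative. *)
  have M0 : 0 < `|M| + 1 by rewrite ltr_wpDl.
  exists (`|M| + 1)^-1; first by rewrite invr_gt0.
  move=> x; rewrite mulrC ler_pdivrMr// mulrC -{1}(TS x).
  apply: (@le_trans _ _ (`|M| * `|T x|)); last by rewrite ler_wpM2r// lerDl.
  apply: le_trans (SM _) _.
  have Mx0 : 0 <= M * `|T x| by apply: le_trans (SM _).
  by rewrite -(ger0_norm Mx0) normrM normr_id.
have injT : injective T.
  move=> x y /eqP; rewrite -subr_eq0 -linearB => /eqP Txy.
  apply/eqP; rewrite -subr_eq0 -normr_le0 -(ler_pM2l c0) mulr0.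
  by rewrite (le_trans (cT _))// Txy normr0.
have [S TS] := choice surjT.
have linS : linear S.
  by move=> a x y; apply: injT; rewrite linearP !TS.
pose S' : {linear V -> V} := HB.pack S (GRing.isLinear.Build _ _ _ _ S linS).
exists S'; split=> //; last by move=> x; apply: injT; rewrite TS.
exists c^-1 => x /=; rewrite mulrC ler_pdivlMr// mulrC.
by apply: le_trans (cT _) _; rewrite TS.
Qed.

Lemma invertible_op_conj S T D (D' : {linear V -> V}) :
    bounded_op D -> bounded_op D' -> cancel D D' -> cancel D' D ->
    (forall x, S (D x) = D (T x)) ->
  invertible_op S -> invertible_op T.
Proof.
move=> [M DM] [M' DM'] DK D'K SD [S' [[c S'c] S'K SS'K]].
exists (D' \o S' \o D); split=> [|x|x] /=.
- exists (`|M'| * `|c| * `|M|) => x /=.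
  have mulr_normr_ge0 a (y z : V) : `|y| <= a * `|z| -> `|y| <= `|a| * `|z|.
    move=> ya; have az : 0 <= a * `|z| by apply: le_trans ya.
    by rewrite -[`|z|]normr_id -normrM ger0_norm.
  rewrite -!mulrA.
  apply: le_trans (mulr_normr_ge0 _ _ _ (DM' _)) _; rewrite ler_wpM2l//.
  apply: le_trans (mulr_normr_ge0 _ _ _ (S'c _)) _; rewrite ler_wpM2l//.
  exact: mulr_normr_ge0.
- by rewrite -[LHS]DK -SD D'K S'K DK.
- by rewrite -SD SS'K DK.
Qed.

End operators.

(** * Norm estimates in l^p(Z) *)

Lemma ltcR0 (R : rcfType) (a : R) : (0 < a%:C) = (0 < a).
Proof. by rewrite -(rmorph0 (real_complex R)) ltcR. Qed.

Lemma normc_real (R : rcfType) (a : R) : Normc.normc a%:C = `|a|.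
Proof. by rewrite /Normc.normc /= expr0n addr0 sqrtr_sqr. Qed.

Lemma normc_gt0 (R : realType) (z : R[i]) : (0 < Normc.normc z) = (z != 0).
Proof.
rewrite lt0r normc_ge0 andbT; congr (~~ _).
by apply/eqP/eqP => [/Normc.eq0_normc|->]; rewrite ?Normc.normc0.
Qed.

Section lp_vectors.
Context {R : realType} {p : R} {p1 : 1 <= p}.
Implicit Types x y z : lp p1.
Local Notation normc := Normc.normc.

Let p0 : 0 < p. Proof. exact: lt_le_trans ltr01 p1. Qed.

(** The norm of [lp p1] takes its values in [R[i]]; its real counterpart lets
    constants be compared in the ordered field [R]. *)
Definition rnorm x : R := lp_norm p x.

Lemma normr_rnorm x : `|x| = (rnorm x)%:C. Proof. exact: lp_normE. Qed.

Lemma rnorm_ge0 x : 0 <= rnorm x. Proof. exact: lp_norm_ge0. Qed.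

Lemma lp_sum_rnorm x : lp_sum p x = (rnorm x `^ p)%:E.
Proof. by rewrite lp_norm_powR// lp_lty. Qed.

Lemma lp_ext x y : (forall n, x n = y n) -> x = y.
Proof. by move=> xy; apply: val_inj; apply/funext. Qed.

Lemma lpB_coord x y n : (x - y) n = x n - y n.
Proof. by []. Qed.

Lemma rnorm_le0 x : rnorm x <= 0 -> x = 0.
Proof.
move=> x0; apply/eqP; rewrite -normr_le0 normr_rnorm.
by rewrite -(rmorph0 (real_complex R)) lecR.
Qed.

Lemma rnorm0 : rnorm 0 = 0.
Proof. by apply: complexI; rewrite -normr_rnorm normr0. Qed.

Lemma rnormD x y : rnorm (x + y) <= rnorm x + rnorm y.
Proof. by have := ler_normD x y; rewrite !normr_rnorm -rmorphD lecR. Qed.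

Lemma rnormN x : rnorm (- x) = rnorm x.
Proof. by have := normrN x; rewrite !normr_rnorm => /complexI. Qed.

Lemma rnormB x y : rnorm (x - y) = rnorm (y - x).
Proof. by rewrite -rnormN opprB. Qed.

Lemma rnormZ c x : rnorm (c *: x) = normc c * rnorm x.
Proof.
by have := normrZ c x; rewrite !normr_rnorm -rmorphM => /complexI.
Qed.

Lemma lerB_rnorm x y : rnorm y - rnorm (x - y) <= rnorm x.
Proof. by rewrite lerBlDr rnormB -{1}(subrK x y) addrC rnormD. Qed.

Lemma normc_coord_le x n : normc (x n) <= rnorm x.
Proof.
rewrite leNgt; apply/negP => xn.
have : ((normc (x n) `^ p)%:E <= lp_sum p x)%E.
  apply: esum_ge; exists [set n]; last by rewrite fsbig_set1.
  by split=> //; exact: finite_set1.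
rewrite lp_sum_rnorm lee_fin leNgt => /negP; apply.
by apply: gt0_ltr_powR => //; rewrite nnegrE ?rnorm_ge0 ?normc_ge0.
Qed.

Lemma lp_invertibleP (T : {linear lp p1 -> lp p1}) : invertible_op T <->
  (exists2 c : R, 0 < c & forall x, c * rnorm x <= rnorm (T x)) /\
  (forall y, exists x, T x = y).
Proof.
rewrite invertible_opP; split=> -[[c c0 cT] surjT]; split=> //.
  have cE : c = (complex.Re c)%:C by rewrite RRe_real// gtr0_real.
  move: c0 cT; rewrite cE -(rmorph0 (real_complex R)) ltcR => c0 cT.
  exists (complex.Re c) => // x.
  by have := cT x; rewrite !normr_rnorm -rmorphM lecR.
exists c%:C => [|x]; first by rewrite ltcR0.
by rewrite !normr_rnorm -rmorphM lecR.
Qed.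

(** Diagonal operators, shifts and the reflection all have the form
    [x |-> a \* (x \o s)]: this bound controls every operator below. *)
Lemma lp_sum_weighted_le (a : int -> R) (s : int -> int) (x : int -> R[i])
    (M : R) : injective s -> (forall n, `|a n| <= M) ->
  (lp_sum p (fun n => (a n)%:C * x (s n))%R <= (M `^ p)%:E * lp_sum p x)%E.
Proof.
move=> s_inj aM; have M0 : 0 <= M by apply: le_trans (aM 0).
rewrite /lp_sum -esumZl ?powR_ge0//; last by move=> i; rewrite lee_fin powR_ge0.
apply: (@le_trans _ _ (\esum_(n in [set: int])
    ((M `^ p)%:E * (normc (x (s n)) `^ p)%:E))%E).
  apply: le_esum => n _; rewrite -EFinM lee_fin Normc.normcM.
  rewrite powRM ?normc_ge0// ler_wpM2r ?powR_ge0//.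
  apply: ge0_ler_powR; rewrite ?nnegrE ?normc_ge0 ?(ltW p0)//.
  by rewrite normc_real.
rewrite -(@esum_image _ _ _ setT s
  (fun n => (M `^ p)%:E * (normc (x n) `^ p)%:E)%E); last first.
  by move=> m n _ _ /s_inj.
rewrite esum_mkcond; apply: le_esum => n _; case: ifP => // _.
by rewrite -EFinM lee_fin mulr_ge0 ?powR_ge0.
Qed.

Lemma rnorm_weighted_le (a : int -> R) (s : int -> int) (M : R) x y :
    injective s -> (forall n, `|a n| <= M) ->
    (forall n, y n = (a n)%:C * x (s n)) ->
  rnorm y <= M * rnorm x.
Proof.
move=> s_inj aM yE; have M0 : 0 <= M by apply: le_trans (aM 0).
apply: lp_norm_le => //; first by rewrite mulr_ge0 ?rnorm_ge0.
rewrite powRM ?rnorm_ge0// EFinM -lp_sum_rnorm.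
have -> : lp_val y = (fun n => (a n)%:C * x (s n)) by apply/funext.
exact: lp_sum_weighted_le.
Qed.

(** The sum over Z splits into two halves, each dominated by a geometric
    series because t^p <= t on [0, 1]. *)
Lemma lp_pred_dominated_exp (q : R) (x : int -> R[i]) : 0 < q < 1 ->
  (forall n : int, normc (x n) <= q ^+ `|n|%N) -> x \in lp_pred p1.
Proof.
move=> /andP[q0 q1] xq; rewrite inE.
have half (s : nat -> int) : (forall k, k <= `|s k|%N)%N -> injective s ->
    (\esum_(n in range s) ((normc (x n)) `^ p)%:E < +oo)%E.
  move=> sk s_inj; rewrite esum_image; last by move=> m n _ _ /s_inj.
  rewrite -nneseries_esumT; last by move=> n; rewrite lee_fin powR_ge0.
  apply: (@le_lt_trans _ _ (\sum_(i <oo) (geometric 1 q i)%:E)%E).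
    apply: lee_nneseries => [i _|i _]; first by rewrite lee_fin powR_ge0.
    rewrite lee_fin /= mul1r.
    have qi n : 0 < q ^+ n <= 1 by rewrite exprn_gt0// exprn_ile1 ?ltW.
    apply: (@le_trans _ _ ((q ^+ `|s i|%N) `^ p)).
      apply: ge0_ler_powR; rewrite ?nnegrE ?normc_ge0 ?(ltW p0)//.
      by rewrite exprn_ge0 ?(ltW q0).
    apply: le_trans (ge1r_powR (qi _) p1) _.
    by rewrite ler_wiXn2l ?ltW.
  rewrite [X in limn X](_ : _ = EFin \o series (geometric 1 q)); last first.
    by apply/funext => n; rewrite /= sumEFin.
  rewrite EFin_lim; last first.
    by apply: is_cvg_geometric_series; rewrite gtr0_norm.
  exact: ltry.
rewrite /lp_sum (esumID (range Posz)); last first.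
  by move=> n _; rewrite lee_fin powR_ge0.
rewrite !setTI; have -> : ~` range Posz = range Negz.
  apply/seteqP; split=> [[n []|n _]| _ [n _ <-] [m _]] //; by exists n.
apply: lte_add_pinfty.
  by apply: half => // m n [].
by apply: half => [k|m n []//]; exact: leqnSn.
Qed.

End lp_vectors.

(** * Completeness of l^p(Z) and perturbation of invertible operators *)

Lemma le0_of_le_exp (R : realType) (a C q : R) : 0 <= q < 1 ->
  (forall k, a <= C * q ^+ k) -> a <= 0.
Proof.
move=> /andP[q0 q1] aC; rewrite leNgt; apply/negP => a0.
have q1' : `|q| < 1 by rewrite ger0_norm.
have /(_ _)/filter_ex[k /=] := cvgr0_norm_lt _ (cvg_geometric C q1') _ a0.
by apply/negP; rewrite -leNgt (le_trans (aC k))// ler_norm.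
Qed.

Section completeness.
Context {R : realType}.
Local Notation normc := Normc.normc.

(** With e_k = D q^k / (1 - q) the sequence u - e increases, u + e decreases,
    and each term of the former is below each term of the latter; the limit is
    the supremum of the former. *)
Lemma geometric_increments_lim (u : nat -> R) (D q : R) : 0 <= q < 1 ->
    (forall k, `|u k.+1 - u k| <= D * q ^+ k) ->
  exists l, forall k, `|l - u k| <= D / (1 - q) * q ^+ k.
Proof.
move=> /andP[q0 q1] uD; have q1' : 1 - q != 0 by rewrite gt_eqF// subr_gt0.
pose e k := D / (1 - q) * q ^+ k.
have eS k : e k - e k.+1 = D * q ^+ k by rewrite /e exprS; field.
have low : {homo (fun k => u k - e k) : m n / (m <= n)%N >-> m <= n}.
  apply: homo_leq => [x|y x z|k]; [exact: lexx|exact: le_trans|].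
  by have := uD k; rewrite ler_norml -eS; lra.
have upp : {homo (fun k => u k + e k) : m n / (m <= n)%N >-> n <= m}.
  apply: homo_leq => [x|y x z xy zx|k]; [exact: lexx|exact: le_trans xy|].
  by have := uD k; rewrite ler_norml -eS; lra.
have D0 : 0 <= D by have := le_trans (normr_ge0 _) (uD 0); rewrite expr0 mulr1.
have e0 k : 0 <= e k.
  apply: mulr_ge0; last exact: exprn_ge0.
  by apply: divr_ge0; rewrite ?subr_ge0 ?(ltW q1).
have low_upp m n : u m - e m <= u n + e n.
  apply: le_trans (low _ _ (leq_maxl m n)) _.
  apply: le_trans (upp _ _ (leq_maxr m n)).
  by have := e0 (maxn m n); lra.
have lows : has_sup (range (fun k => u k - e k)).
  by split; [exists (u 0 - e 0), 0 | exists (u 0 + e 0) => _ [k _ <-]].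
exists (sup (range (fun k => u k - e k))) => k; rewrite ler_norml -/(e k).
have : u k - e k <= sup (range (fun k => u k - e k)).
  by apply: sup_upper_bound => //; exists k.
have : sup (range (fun k => u k - e k)) <= u k + e k.
  by apply: ge_sup => [|_ [m _ <-]] //; exact: lows.1.
lra.
Qed.

Lemma normc_le_ReIm (z : R[i]) :
  normc z <= `|complex.Re z| + `|complex.Im z|.
Proof.
case: z => a b; rewrite /Normc.normc /=.
rewrite -(@ger0_norm _ (`|a| + `|b|)) ?addr_ge0//.
rewrite -sqrtr_sqr ler_wsqrtr// sqrrD !real_normK ?num_real//.
by rewrite lerD2r lerDl mulrn_wge0// mulr_ge0.
Qed.

Lemma ReIm_le_normc (z : R[i]) :
  (`|complex.Re z| <= normc z) /\ (`|complex.Im z| <= normc z).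
Proof.
case: z => a b; rewrite /Normc.normc /= -!sqrtr_sqr !ler_wsqrtr//.
- by rewrite lerDr sqr_ge0.
- by rewrite lerDl sqr_ge0.
Qed.

Lemma geometric_increments_limc (u : nat -> R[i]) (D q : R) : 0 <= q < 1 ->
    (forall k, normc (u k.+1 - u k) <= D * q ^+ k) ->
  exists l, forall k, normc (l - u k) <= 2 * D / (1 - q) * q ^+ k.
Proof.
move=> q01 uD.
have [|a aP] := @geometric_increments_lim (fun k => complex.Re (u k)) D q q01.
  by move=> k; rewrite -raddfB; apply: le_trans (ReIm_le_normc _).1 (uD k).
have [|b bP] := @geometric_increments_lim (fun k => complex.Im (u k)) D q q01.
  by move=> k; rewrite -raddfB; apply: le_trans (ReIm_le_normc _).2 (uD k).
exists (a +i* b) => k; apply: le_trans (normc_le_ReIm _) _.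
rewrite !raddfB/=; apply: le_trans (lerD (aP k) (bP k)) _.
by rewrite le_eqVlt; apply/orP; left; apply/eqP; ring.
Qed.

End completeness.

Section completeness_lp.
Context {R : realType} {p : R} {p1 : 1 <= p}.
Local Notation normc := Normc.normc.

Let p0 : 0 < p. Proof. exact: lt_le_trans ltr01 p1. Qed.

(** A version of Fatou's lemma.  Losing a factor 2 makes the hypothesis true
    eventually along any coordinatewise convergent sequence: trivially at the
    zeros of z, and from the limit of the moduli elsewhere. *)
Lemma lp_sum_le_coordinatewise (z : int -> R[i]) (u : nat -> int -> R[i])
    (c : \bar R) :
    (forall m, lp_sum p (u m) <= c)%E ->
    (forall n, \forall m \near \oo, normc (z n) <= 2 * normc (u m n)) ->
  (lp_sum p z <= (2 `^ p)%:E * c)%E.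
Proof.
move=> uc zu; apply: ge_ereal_sup => _ [X [Xfin _] <-].
have [m zum] : exists m, forall n, X n -> normc (z n) <= 2 * normc (u m n).
  have := @filter_bigI _ _ (fset_set X)
    (fun n => [set m | normc (z n) <= 2 * normc (u m n)])
    \oo _ (fun n _ => zu n).
  move=> /(_ _)/filter_ex[m mX]; exists m => n Xn.
  by have := mX n; apply; rewrite /= in_fset_set// inE.
apply: (@le_trans _ _ (lp_sum p ((2 : R)%:C *: u m))); last first.
  rewrite lp_sumZ// normc_real ger0_norm//.
  by apply: lee_wpmul2l => //; rewrite lee_fin powR_ge0.
apply: esum_ge; exists X => //.
rewrite !fsbig_finite//= !sumEFin lee_fin big_seq [leRHS]big_seq.
apply: ler_sum => n; rewrite in_fset_set// inE => Xn.
apply: ge0_ler_powR; rewrite ?nnegrE ?normc_ge0 ?(ltW p0)//.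
apply: le_trans (zum n Xn) _; rewrite Normc.normcM ler_wpM2r ?normc_ge0//.
by rewrite normc_real ger0_norm.
Qed.

(** Completeness of l^p(Z), for sequences with geometric increments. *)
Lemma lp_geometric_lim (x : nat -> lp p1) (D q : R) : 0 <= q < 1 ->
    (forall k, rnorm (x k.+1 - x k) <= D * q ^+ k) ->
  exists y E, forall k, rnorm (y - x k) <= E * q ^+ k.
Proof.
move=> q01 xD; have /andP[q0 q1] := q01.
have D0 : 0 <= D by have := le_trans (rnorm_ge0 _) (xD 0); rewrite expr0 mulr1.
have [E E0 ED] : exists2 E, 0 <= E & E - E * q = D.
  exists (D / (1 - q)); first by apply: divr_ge0; rewrite ?subr_ge0 ?(ltW q1).
  by field; rewrite gt_eqF// subr_gt0.
have tail m k : rnorm (x (k + m)%N - x k) <= E * q ^+ k - E * q ^+ (k + m)%N.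
  elim: m => [|m IHm]; first by rewrite addn0 !subrr rnorm0.
  rewrite -(subrK (x (k + m)%N) (x (k + m.+1)%N)) -addrA.
  apply: le_trans (rnormD _ _) _; rewrite addnS.
  apply: le_trans (lerD (xD _) IHm) _; rewrite -{1}ED exprS.
  by rewrite le_eqVlt; apply/orP; left; apply/eqP; ring.
have [l lP] := choice (fun n => geometric_increments_limc q01
  (fun k => le_trans (normc_coord_le (x k.+1 - x k) n) (xD k))).
have yx k : (lp_sum p (l - x k)%R <= (2 `^ p)%:E * ((E * q ^+ k) `^ p)%:E)%E.
  apply: (@lp_sum_le_coordinatewise _ (fun m => lp_val (x (k + m)%N - x k))).
    move=> m; rewrite lp_sum_rnorm lee_fin.
    apply: ge0_ler_powR;
      rewrite ?nnegrE ?rnorm_ge0 ?mulr_ge0 ?exprn_ge0 ?(ltW p0)//.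
    by apply: le_trans (tail m k) _; rewrite lerBlDr lerDl mulr_ge0 ?exprn_ge0.
  move=> n; change (\forall m \near \oo,
    normc (l n - x k n) <= 2 * normc (x (k + m)%N n - x k n)).
  have [z0|z0] := eqVneq (l n - x k n) 0.
    by near=> m; rewrite z0 Normc.normc0 mulr_ge0 ?normc_ge0.
  have {}z0 : 0 < normc (l n - x k n) / 2 by rewrite divr_gt0// normc_gt0.
  have q1' : `|q| < 1 by rewrite ger0_norm.
  have /(_ _) := cvgr0_norm_lt _ (cvg_geometric (2 * D / (1 - q)) q1') _ z0.
  apply: filterS => m /=; rewrite ger0_norm; last first.
    by rewrite !mulr_ge0 ?exprn_ge0 ?invr_ge0 ?subr_ge0 ?(ltW q1).
  move: (lP n (k + m)%N); set a := normc _ => la.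
  have : 2 * D / (1 - q) * q ^+ (k + m) <= 2 * D / (1 - q) * q ^+ m.
    rewrite ler_wpM2l ?ler_wiXn2l ?leq_addl ?(ltW q1)//.
    by rewrite !mulr_ge0 ?invr_ge0 ?subr_ge0 ?(ltW q1).
  have := le_normcD (l n - x (k + m)%N n) (x (k + m)%N n - x k n).
  rewrite addrA subrK -/a; move: la; set b := normc _; set b' := normc _.
  move: (_ * _) (_ * _) => d d'; lra.
have lin : l \in lp_pred p1.
  rewrite -(subrK (lp_val (x 0%N)) l) rpredD ?lp_valP// inE.
  exact: le_lt_trans (yx 0%N) (ltry _).
exists (Lp lin), (2 * E) => k; rewrite -mulrA.
apply: lp_norm_le => //; first by rewrite !mulr_ge0 ?exprn_ge0.
rewrite powRM ?mulr_ge0 ?exprn_ge0// EFinM.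
exact: yx.
Unshelve. all: by end_near. Qed.

(** The Banach fixed point theorem, by Picard iteration from 0. *)
Lemma lp_contraction_fixpoint (f : lp p1 -> lp p1) (q : R) : 0 <= q < 1 ->
    (forall x y, rnorm (f x - f y) <= q * rnorm (x - y)) ->
  exists x, f x = x.
Proof.
move=> q01 fq; have /andP[q0 q1] := q01; pose x k := iter k f 0.
have [|y [E yE]] := @lp_geometric_lim x (rnorm (f 0)) q q01.
  elim=> [|k IHk]; first by rewrite expr0 mulr1 /= subr0.
  by apply: le_trans (fq _ _) _; rewrite exprS mulrCA ler_wpM2l.
exists y; apply/eqP; rewrite -subr_eq0; apply/eqP/rnorm_le0.
apply: (@le0_of_le_exp _ _ (2 * E) q) => // k.
rewrite -(subrK (x k.+1) (f y)) -addrA; apply: le_trans (rnormD _ _) _.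
rewrite [rnorm (x _ - _)]rnormB.
have := fq y (x k); have := yE k.+1; have := yE k.
rewrite exprS mulrCA => yk yk1 fyk.
apply: le_trans (lerD (le_trans fyk (ler_wpM2l q0 yk)) yk1) _.
rewrite -mulr2n -[leRHS]mulrA [leRHS]mulr_natl lerMn2r/= ler_piMl ?(ltW q1)//.
exact: le_trans (rnorm_ge0 _) yk.
Qed.

(** Solving S x = y amounts to finding a fixed point of
    x |-> T^-1 (y - (S - T) x), a contraction of ratio e / c. *)
Lemma invertible_op_perturbation (S T : {linear lp p1 -> lp p1}) (c e : R) :
    0 <= e < c -> (forall x, c * rnorm x <= rnorm (T x)) ->
    (forall y, exists x, T x = y) ->
    (forall x, rnorm (S x - T x) <= e * rnorm x) ->
  invertible_op S.
Proof.
move=> /andP[e0 ec] Tc surjT STe; have c0 : 0 < c by exact: le_lt_trans ec.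
apply/lp_invertibleP; split.
  exists (c - e) => [|x]; first by rewrite subr_gt0.
  by rewrite mulrBl; apply: le_trans (lerB_rnorm (S x) (T x)); exact: lerB.
move=> y; have [g gT] := choice surjT.
have [||x gx] :=
  @lp_contraction_fixpoint (fun x => g (y - (S x - T x))) (e / c).
- by rewrite divr_ge0 ?(ltW c0)//= ltr_pdivrMr ?mul1r.
- move=> a b; rewrite mulrAC ler_pdivlMr// mulrC.
  apply: le_trans (Tc _) _; rewrite linearB !gT.
  have -> : y - (S a - T a) - (y - (S b - T b)) = S (b - a) - T (b - a).
    by rewrite [- (y - _)]opprB addrC addrA subrK !linearB/= !opprK addrACA.
  by rewrite [rnorm (a - b)]rnormB.
- exists x; apply: (addIr (T x - S x)).
  by rewrite addrC subrK -{1}gx gT opprB.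
Qed.

End completeness_lp.

(** * Bilateral products *)

Section bilateral_products.
Context {K : fieldType}.
Implicit Types g : int -> K.

(** The solution of a_(n+1) = g_n a_n over Z with a_0 = 1. *)
Definition bilateral_prod g (n : int) : K :=
  match n with
  | Posz m => \prod_(i < m) g (Posz i)
  | Negz m => (\prod_(i < m.+1) g (Negz i))^-1
  end.

Lemma bilateral_prodS g n : (forall k, g k != 0) ->
  bilateral_prod g (n + 1) = g n * bilateral_prod g n.
Proof.
move=> g0; case: n => [m|[|m]].
- by rewrite -PoszD addn1 /= big_ord_recr mulrC.
- by rewrite /= big_ord0 big_ord1 mulfV.
- have -> : Negz m.+1 + 1 = Negz m by rewrite !NegzE; lia.
  by rewrite /= [in RHS]big_ord_recr/= invfM mulrCA mulfV// mulr1.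
Qed.

Lemma bilateral_prod_neq0 g n : (forall k, g k != 0) -> bilateral_prod g n != 0.
Proof.
by move=> g0; case: n => m /=; rewrite ?invr_eq0; apply/prodf_neq0 => i _.
Qed.

Lemma bilateral_prodV g h n : (forall k, h k = (g k)^-1) ->
  bilateral_prod h n = (bilateral_prod g n)^-1.
Proof.
move=> hg; case: n => m /=; rewrite -[in RHS]prodfV; first exact: eq_bigr.
by congr (_^-1); exact: eq_bigr.
Qed.

End bilateral_products.

Lemma bilateral_prod_decay (K : numFieldType) (g : int -> K) (q : K) : 0 < q ->
    (forall n : nat, `|g (Posz n)| <= q) ->
    (forall n : nat, q^-1 <= `|g (Negz n)|) ->
  forall n, `|bilateral_prod g n| <= q ^+ `|n|%N.
Proof.
move=> q0 gpos gneg [m|m] /=.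
  rewrite normr_prod -[m in leRHS]card_ord -prodr_const.
  by apply: ler_prod => i _; rewrite normr_ge0 gpos.
rewrite normfV normr_prod invf_ple ?posrE ?exprn_gt0//; last first.
  by apply: prodr_gt0 => i _; apply: lt_le_trans (gneg i); rewrite invr_gt0.
rewrite -exprVn -[m.+1 in leLHS]card_ord -prodr_const.
by apply: ler_prod => i _; rewrite gneg invr_ge0 ltW.
Qed.

Lemma eventually_constant_ub (R : realDomainType) (a : nat -> R) (N : nat) :
    (forall m, 0 <= a m) -> (forall m, (N <= m)%N -> a m.+1 = a m) ->
  exists M, forall m, a m <= M.
Proof.
move=> a0 aS; exists (\sum_(i < N.+1) a i) => m.
have low i : (i <= N)%N -> a i <= \sum_(i < N.+1) a i.
  rewrite -ltnS => iN; rewrite (bigD1 (Ordinal iN))//= lerDl.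
  by apply: sumr_ge0 => j _.
have [/low//|/ltnW/subnK <-] := leqP m N.
elim: (m - N)%N => [|k IHk]; first exact: low.
by rewrite addSn aS// leq_addl.
Qed.

(** The product is constant far away on each side. *)
Lemma bilateral_prod_ub (R : realFieldType) (g : int -> R) (N : nat) :
    (forall n, 0 < g n) -> (forall n : int, (N <= `|n|)%N -> g n = 1) ->
  exists M, forall n, `|bilateral_prod g n| <= M.
Proof.
move=> g0 g1; have gN0 n : g n != 0 by rewrite gt_eqF.
have [|m Nm|M1 M1P] := @eventually_constant_ub R
  (fun m => `|bilateral_prod g (Posz m)|) N; first by [].
  by rewrite -addn1 PoszD bilateral_prodS// g1// mul1r.
have [|m Nm|M2 M2P] := @eventually_constant_ub R
  (fun m => `|bilateral_prod g (Negz m)|) N; first by [].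
  have <- : Negz m.+1 + 1 = Negz m by rewrite !NegzE; lia.
  by rewrite bilateral_prodS// g1 ?mul1r// leqW// leqW.
exists (Num.max M1 M2) => -[m|m]; rewrite le_max ?M1P//.
by apply/orP; right; exact: M2P.
Qed.

(** * Weighted composition operators *)

Lemma bounded_funP (R : realType) (a : int -> R) :
  bounded_fun a <-> exists M, forall n, `|a n| <= M.
Proof.
split=> [ab|[M aM]].
  have [M aM] :=
    (@ex_bound _ _ _ a _ (globally_properfilter (I : [set: int] 0))).1 ab.
  by exists M => n; exact: aM.
apply: (@ex_bound _ _ _ a _ (globally_properfilter (I : [set: int] 0))).2.
by exists M => n _; exact: aM.
Qed.

Section weighted_composition.
Context {R : realType} {p : R} {p1 : 1 <= p}.
Variables (a : int -> R) (s : int -> int).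
Hypotheses (ab : bounded_fun a) (s_inj : injective s).

(** Real weights followed by a reindexing: the common shape of the diagonal
    operators, of the inverse of a shift and of the reflection of Z. *)
Definition weighted_comp_fun (x : lp p1) : int -> R[i] :=
  fun n => (a n)%:C * x (s n).

Lemma weighted_comp_subproof x : weighted_comp_fun x \in lp_pred p1.
Proof.
have [M aM] := (bounded_funP a).1 ab.
rewrite inE; apply: le_lt_trans (lp_sum_weighted_le (p1 := p1) x s_inj aM) _.
by rewrite lp_sum_rnorm -EFinM ltry.
Qed.

Definition weighted_comp (x : lp p1) : lp p1 := Lp (weighted_comp_subproof x).

Lemma weighted_comp_is_linear : linear weighted_comp.
Proof.
move=> c x y; apply: val_inj; apply/funext => n /=.
rewrite /weighted_comp_fun /=.
by rewrite [LHS]mulrDr; congr (_ + _); exact: mulrCA.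
Qed.

HB.instance Definition _ := GRing.isLinear.Build R[i] (lp p1) (lp p1) _
  weighted_comp weighted_comp_is_linear.

Lemma weighted_comp_bounded : bounded_op weighted_comp.
Proof.
have [M aM] := (bounded_funP a).1 ab; exists M%:C => x.
rewrite !normr_rnorm -rmorphM lecR.
exact: (rnorm_weighted_le s_inj aM).
Qed.

End weighted_composition.

(** * Resolvent estimates for the forward shift *)

Section forward_shift_spectrum.
Context {R : realType} {p : R} {p1 : 1 <= p}.
Local Notation normc := Normc.normc.
Local Notation shift wb := (@forward_shift R p p1 _ wb).
Local Notation "T ~- l" := (T \- l \*: idfun : {linear lp p1 -> lp p1})
  (at level 50).
Implicit Types (w u : int -> R) (l : R[i]).

Lemma shift_coord w (wb : bounded_fun w) x n :
  shift wb x n = (w (n - 1))%:C * x (n - 1).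
Proof. by []. Qed.

Lemma shift_sub_coord w (wb : bounded_fun w) l x n :
  (shift wb ~- l) x n = (w (n - 1))%:C * x (n - 1) - l * x n.
Proof. by []. Qed.

(** The diagonal operator D with entries d intertwines the two shifts as soon
    as u_n d_(n+1) = w_n d_n; it is invertible because d and 1 / d are products
    of ratios equal to 1 off a finite set. *)
Lemma invertible_shift_finite_change w u (wb : bounded_fun w)
    (ub : bounded_fun u) (N : nat) l :
    (forall n, 0 < w n) -> (forall n, 0 < u n) ->
    (forall n : int, (N <= `|n|)%N -> w n = u n) ->
  invertible_op (shift wb ~- l) -> invertible_op (shift ub ~- l).
Proof.
move=> w0 u0 wu.
have bounded_prod (v v' : int -> R) : (forall n, 0 < v n) ->
    (forall n, 0 < v' n) -> (forall n : int, (N <= `|n|)%N -> v n = v' n) ->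
    bounded_fun (bilateral_prod (fun n => v n / v' n)).
  move=> v0 v'0 vv'; apply/bounded_funP.
  apply: (@bilateral_prod_ub _ _ N) => [n|n Nn]; first exact: divr_gt0.
  by rewrite vv'// divff// gt_eqF.
pose d := bilateral_prod (fun n => w n / u n).
pose d' := bilateral_prod (fun n => u n / w n).
have ratio0 (v v' : int -> R) : (forall n, 0 < v n) -> (forall n, 0 < v' n) ->
    forall n, v n / v' n != 0.
  by move=> v0 v'0 n; rewrite gt_eqF// divr_gt0.
have dS n : u n * d (n + 1) = w n * d n.
  rewrite /d bilateral_prodS; last exact: ratio0.
  by field; rewrite gt_eqF.
have dd' n : d n * d' n = 1.
  have -> : d' n = (d n)^-1.
    by apply: bilateral_prodV => k; rewrite invf_div.
  by rewrite mulfV//; apply: bilateral_prod_neq0; exact: ratio0.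
have id_inj : injective (@id int) by [].
pose D : {linear lp p1 -> lp p1} := weighted_comp
  (bounded_prod _ _ w0 u0 wu) id_inj.
pose D' : {linear lp p1 -> lp p1} := weighted_comp
  (bounded_prod _ _ u0 w0 (fun n Nn => esym (wu n Nn))) id_inj.
apply: (@invertible_op_conj _ _ _ _ D D').
- exact: weighted_comp_bounded.
- exact: weighted_comp_bounded.
- move=> x; apply: lp_ext => n /=; rewrite /weighted_comp_fun/=.
  rewrite /weighted_comp_fun mulrA -rmorphM/= -/d' -/d.
  by rewrite [d' n * _]mulrC dd' mul1r.
- move=> x; apply: lp_ext => n /=; rewrite /weighted_comp_fun/=.
  by rewrite /weighted_comp_fun mulrA -rmorphM/= -/d' -/d dd' mul1r.
- move=> x; apply: lp_ext => n.
  rewrite shift_sub_coord /= /weighted_comp_fun -/d shift_sub_coord.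
  rewrite mulrBr !mulrA -!rmorphM/= -dS subrK.
  by rewrite [d n * _]mulrC [_ * l]mulrC.
Qed.

(** Here F is a perturbation of the homothety of ratio - l. *)
Lemma invertible_shift_small u (ub : bounded_fun u) (r : R) l :
    (forall n, 0 < u n <= r) -> r < normc l -> invertible_op (shift ub ~- l).
Proof.
move=> ur rl; have r0 : 0 <= r by have /andP[/ltW/le_trans] := ur 0; apply.
have l0 : l != 0.
  by apply: contraTneq rl => ->; rewrite Normc.normc0 -leNgt.
apply: (@invertible_op_perturbation _ _ _ _
  ((- l) \*: idfun : {linear lp p1 -> lp p1}) (normc l) r).
- by rewrite r0.
- by move=> x /=; rewrite rnormZ normcN.
- move=> y; exists ((- l)^-1 *: y).
  by rewrite /= scalerA mulfV ?scale1r ?oppr_eq0.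
- move=> x.
  apply: (@rnorm_weighted_le _ _ _ (fun n => u (n - 1)) (fun n => n - 1)).
  + exact: addIr.
  + by move=> n; have /andP[/ltW un0 unr] := ur (n - 1); rewrite ger0_norm.
  + move=> n; rewrite -shift_coord.
    by congr (lp_val _ n); rewrite /= scaleNr opprK subrK.
Qed.

(** Here - l is a perturbation of F, which has the lower bound r and whose
    inverse is the backward shift dividing by the weights. *)
Lemma invertible_shift_large u (ub : bounded_fun u) (r : R) l :
    0 < r -> (forall n, r <= u n) -> normc l < r ->
  invertible_op (shift ub ~- l).
Proof.
move=> r0 ru lr; have u0 n : 0 < u n by exact: lt_le_trans (ru n).
have uVr n : `|(u n)^-1| <= r^-1.
  by rewrite ger0_norm ?invr_ge0 ?(ltW (u0 n))// lef_pV2 ?posrE.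
have succ_inj : injective (fun n : int => n + 1) by exact: addIr.
apply: (@invertible_op_perturbation _ _ _ _
  (shift ub : {linear lp p1 -> lp p1}) r (normc l)).
- by rewrite normc_ge0.
- move=> x; rewrite -ler_pdivlMl//.
  apply: (rnorm_weighted_le succ_inj uVr) => n.
  by rewrite shift_coord addrK mulrA -rmorphM/= mulVf ?mul1r// gt_eqF.
- move=> y; have uVb := (bounded_funP _).2 (ex_intro _ _ uVr).
  exists (weighted_comp uVb succ_inj y); apply: lp_ext => n.
  rewrite shift_coord /= /weighted_comp_fun subrK mulrA -rmorphM/=.
  by rewrite mulfV ?mul1r// gt_eqF.
- move=> x; rewrite -rnormZ -[rnorm (l *: x)]rnormN le_eqVlt; apply/orP; left.
  by apply/eqP; congr rnorm; rewrite /= addrC addKr.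
Qed.

(** Tilting moves the limits of the weights in opposite directions. *)
Definition tilt (e : R) w (n : int) : R :=
  if n is Posz _ then (1 - e) * w n else (1 + e) * w n.

(** Since w is bounded, a slight tilt is a perturbation of small norm. *)
Lemma invertible_shift_tilt w (wb : bounded_fun w) l :
    invertible_op (shift wb ~- l) ->
  exists2 e : R, 0 < e < 1 & forall e' (vb : bounded_fun (tilt e' w)),
    `|e'| <= e -> invertible_op (shift vb ~- l).
Proof.
move=> /lp_invertibleP[[c c0 Tc] surjT].
have [M0 wM0] := (bounded_funP _).1 wb; pose M := Num.max M0 1.
have M0' : 0 < M by rewrite lt_max ltr01 orbT.
have wM n : `|w n| <= M by rewrite le_max wM0.
pose e := Num.min (c / M) 1 / 2.
have eP : [/\ 0 < e, e < 1 & e * M < c].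
  have m0 : 0 < Num.min (c / M) 1 by rewrite lt_min ltr01 divr_gt0.
  have m1 : Num.min (c / M) 1 <= 1 by rewrite ge_min lexx orbT.
  have mc : Num.min (c / M) 1 <= c / M by rewrite ge_min lexx.
  by rewrite -[e * M < c]ltr_pdivlMr// /e; split; lra.
have [e0 e1 eM] := eP; exists e => [|e' vb e'e]; first by rewrite e0.
apply: (@invertible_op_perturbation _ _ _ _
  (shift wb ~- l : {linear lp p1 -> lp p1}) c (e * M)) => //.
  by rewrite eM mulr_ge0 ?ltW.
move=> x; apply: (@rnorm_weighted_le _ _ _
  (fun n => tilt e' w (n - 1) - w (n - 1)) (fun n => n - 1)) => [|n|n].
- exact: addIr.
- apply: (@le_trans _ _ (`|e'| * `|w (n - 1)|)); last exact: ler_pM.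
  rewrite -normrM /tilt; case: (n - 1) => m.
    by rewrite -normrN le_eqVlt; apply/orP; left; apply/eqP; congr `|_|; ring.
  by rewrite le_eqVlt; apply/orP; left; apply/eqP; congr `|_|; ring.
- rewrite lpB_coord !shift_sub_coord.
  by rewrite rmorphB/=; ring.
Qed.

(** The solution of l x_(n+1) = u_n x_n is an eigenvector; it is summable
    because |u_n / l| <= q on the right and |u_n / l| >= 1 / q on the left. *)
Lemma not_invertible_shift_eigenvector u (ub : bounded_fun u) (q : R) l :
    l != 0 -> 0 < q < 1 -> (forall n, 0 < u n) ->
    (forall n : nat, u (Posz n) <= q * normc l) ->
    (forall n : nat, normc l <= q * u (Negz n)) ->
  ~ invertible_op (shift ub ~- l).
Proof.
move=> l0 q01 u0 upos uneg /lp_invertibleP[[c c0 Tc] _].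
have nl0 : 0 < normc l by rewrite normc_gt0.
have /andP[q0 _] := q01.
pose g n : R[i] := (u n)%:C / l.
have normg n : `|g n| = (u n / normc l)%:C.
  rewrite normrM normfV -[`|l|]/((normc l)%:C).
  by rewrite gtr0_norm ?ltcR0// rmorphM fmorphV.
have g0 n : g n != 0.
  by rewrite mulf_neq0 ?invr_eq0// gt_eqF ?ltcR0.
have xin : bilateral_prod g \in lp_pred p1.
  apply: (lp_pred_dominated_exp q01) => n.
  suff : `|bilateral_prod g n| <= q%:C ^+ `|n|%N by rewrite -rmorphXn lecR.
  apply: bilateral_prod_decay => [|m|m]; first by rewrite ltcR0.
    by rewrite normg lecR ler_pdivrMr.
  by rewrite normg -fmorphV lecR ler_pdivlMr// mulrC ler_pdivrMr// mulrC.
have x_eigen : (shift ub ~- l) (Lp xin) = 0.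
  apply: lp_ext => n; rewrite shift_sub_coord /= -{3}(subrK 1 n).
  by rewrite bilateral_prodS// /g mulrA [l * _]mulrC divfK// subrr.
have := Tc (Lp xin); rewrite x_eigen rnorm0 pmulr_rle0// leNgt => /negP; apply.
apply: lt_le_trans (normc_coord_le _ 0).
by rewrite /= big_ord0 Normc.normc1.
Qed.

(** The solution f of u_n f_(n+1) = l f_n is an eigenvector of the transpose.
    If (F - l) y = e_0, then z = f y is constant on n >= 0 and on n < 0.  As f
    decays and y is bounded, both constants are 0, whereas the equation at
    n = 0 reads l z_0 = l z_(-1) - 1. *)
Lemma not_invertible_shift_functional u (ub : bounded_fun u) (q : R) l :
    l != 0 -> 0 < q < 1 -> (forall n, 0 < u n) ->
    (forall n : nat, normc l <= q * u (Posz n)) ->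
    (forall n : nat, u (Negz n) <= q * normc l) ->
  ~ invertible_op (shift ub ~- l).
Proof.
move=> l0 q01 u0 upos uneg /lp_invertibleP[_ surjT].
have nl0 : 0 < normc l by rewrite normc_gt0.
have /andP[q0 q1] := q01.
have uc0 n : (u n)%:C != 0 :> R[i] by rewrite gt_eqF ?ltcR0.
pose g n : R[i] := l / (u n)%:C.
have normg n : `|g n| = (normc l / u n)%:C.
  rewrite normrM normfV -[`|l|]/((normc l)%:C).
  by rewrite gtr0_norm ?ltcR0// rmorphM fmorphV.
have g0 n : g n != 0 by rewrite mulf_neq0 ?invr_eq0.
pose f := bilateral_prod g.
have f_decay n : normc (f n) <= q ^+ `|n|%N.
  suff : `|f n| <= q%:C ^+ `|n|%N by rewrite -rmorphXn lecR.
  apply: bilateral_prod_decay => [|m|m]; first by rewrite ltcR0.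
    by rewrite normg lecR ler_pdivrMr.
  by rewrite normg -fmorphV lecR ler_pdivlMr// mulrC ler_pdivrMr// mulrC.
have ein : (fun n : int => (n == 0)%:R : R[i]) \in lp_pred p1.
  apply: (lp_pred_dominated_exp q01) => n; case: eqVneq => [->|_].
    by rewrite Normc.normc1.
  by rewrite Normc.normc0 exprn_ge0 ?ltW.
have [y ye] := surjT (Lp ein); pose z n := f n * y n.
have zS n : l * z (n + 1) = l * z n - f (n + 1) * (n + 1 == 0)%:R.
  have := congr1 (fun x : lp p1 => x (n + 1)) ye.
  rewrite shift_sub_coord /= addrK => <-.
  rewrite /z /f bilateral_prodS// -/f /g; field.
  exact: uc0.
have z_decay n : normc (z n) <= rnorm y * q ^+ `|n|%N.
  rewrite Normc.normcM mulrC.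
  by apply: ler_pM; rewrite ?normc_ge0 ?normc_coord_le.
have zS0 n : n + 1 != 0 -> z (n + 1) = z n.
  by move=> n0; apply: (mulfI l0); rewrite zS (negPf n0) mulr0 subr0.
have zpos (m : nat) : z (Posz m) = z 0.
  by elim: m => // m IHm; rewrite -addn1 PoszD zS0.
have zneg (m : nat) : z (Negz m) = z (-1).
  elim: m => // m <-; have E : Negz m.+1 + 1 = Negz m by rewrite !NegzE; lia.
  by rewrite -E zS0// E.
have z0 : z 0 = 0.
  apply: Normc.eq0_normc; apply/eqP; rewrite eq_le normc_ge0 andbT.
  apply: (@le0_of_le_exp _ _ (rnorm y) q) => [|k]; first by rewrite q1 ltW.
  by rewrite -(zpos k).
have zN1 : z (-1) = 0.
  apply: Normc.eq0_normc; apply/eqP; rewrite eq_le normc_ge0 andbT.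
  apply: (@le0_of_le_exp _ _ (rnorm y) q) => [|k]; first by rewrite q1 ltW.
  rewrite -(zneg k); apply: le_trans (z_decay _) _.
  by rewrite ler_wpM2l ?rnorm_ge0//= ler_wiXn2l ?(ltW q0) ?(ltW q1).
have := zS (-1); rewrite addNr z0 zN1 eqxx /f /= big_ord0.
by rewrite !mulr0 mulr1 sub0r => /eqP; rewrite eq_sym oppr_eq0 oner_eq0.
Qed.

(** The shift sends e_n to w_n e_(n+1), so its lower bound is at most w_n. *)
Lemma invertible_shift_lb w (wb : bounded_fun w) : (forall n, 0 < w n) ->
  invertible_op (shift wb ~- 0) -> exists2 c : R, 0 < c & forall n, c <= w n.
Proof.
move=> w0 /lp_invertibleP[[c c0 Tc] _]; exists c => // n.
have half01 : 0 < (2^-1 : R) < 1 by rewrite invr_gt0 ltr0n invf_lt1 ?ltr1n.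
(* The factor 2^-|n| scales e_n below the exponential that yields membership
   in l^p(Z). *)
have xin : (fun k : int => ((k == n)%:R * 2^-1 ^+ `|n|%N)%:C) \in lp_pred p1.
  apply: (lp_pred_dominated_exp half01) => k; rewrite normc_real.
  have pow0 (m : nat) : 0 <= (2^-1 : R) ^+ m by rewrite exprn_ge0// invr_ge0.
  by case: eqVneq => [->|_]; rewrite ?mul1r ?mul0r ?normr0 ?ger0_norm.
have x0 : 0 < rnorm (Lp xin).
  apply: lt_le_trans (normc_coord_le _ n).
  rewrite -[lp_val _ n]/((n == n)%:R * 2^-1 ^+ `|n|%N)%:C normc_real eqxx mul1r.
  by rewrite normr_gt0 expf_neq0// invr_eq0.
rewrite -(ler_pM2r x0); apply: le_trans (Tc _) _.
apply: (@rnorm_weighted_le _ _ _ (fun k => (k - 1 == n)%:R * w n)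
  (fun k => k - 1)) => [|k|k].
- exact: addIr.
- by rewrite normrM (gtr0_norm (w0 n)); case: eqVneq => _;
    rewrite ?normr1 ?normr0 ?mul1r ?mul0r ?(ltW (w0 n)).
- rewrite shift_sub_coord /= mul0r subr0 -!rmorphM/=.
  by case: eqVneq => [->|_]; rewrite ?mul1r ?mul0r ?mulr0.
Qed.

Definition clip (f g : R -> R) w (n : int) : R :=
  if n is Posz _ then f (w n) else g (w n).

(** As clipping leaves the weights unchanged near both ends, it changes
    finitely many of them. *)
Lemma invertible_shift_clip w (wb : bounded_fun w) (f g : R -> R) (C D : R) :
    (forall n, 0 < w n) ->
    (forall x, 0 < x -> 0 < f x <= x + C) ->
    (forall x, 0 < x -> 0 < g x <= x + D) ->
    (\forall n \near \oo, f (w n%:Z) = w n%:Z) ->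
    (\forall n \near \oo, g (w (- n%:Z)) = w (- n%:Z)) ->
  exists ub : bounded_fun (clip f g w), forall l,
    invertible_op (shift wb ~- l) <-> invertible_op (shift ub ~- l).
Proof.
move=> w0 fP gP [N1 _ fN] [N2 _ gN].
have [M wM] := (bounded_funP _).1 wb.
have u0 n : 0 < clip f g w n.
  case: n => n /=; first by have /andP[] := fP _ (w0 n).
  by have /andP[] := gP _ (w0 (Negz n)).
have ub : bounded_fun (clip f g w).
  apply/bounded_funP; exists (M + Num.max C D) => n; rewrite gtr0_norm//.
  have := le_trans (ler_norm _) (wM n); case: n => n /= wnM.
    have /andP[_ /le_trans] := fP _ (w0 n); apply.
    by apply: lerD => //; rewrite le_max lexx.
  have /andP[_ /le_trans] := gP _ (w0 (Negz n)); apply.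
  by apply: lerD => //; rewrite le_max lexx orbT.
have wu (n : int) : (maxn N1 N2 <= `|n|)%N -> w n = clip f g w n.
  rewrite geq_max; case: n => n /= /andP[Nn1 Nn2]; first by rewrite fN.
  by have := gN n.+1 Nn2; rewrite NegzE.
exists ub => l; split;
  apply: (@invertible_shift_finite_change _ _ _ _ (maxn N1 N2)) => //.
by move=> n /wu.
Qed.

Lemma clip_min (r : R) : 0 < r -> forall x, 0 < x -> 0 < Num.min r x <= x + r.
Proof. by move=> r0 x x0; rewrite lt_min r0 x0 ge_min lerDl (ltW r0) orbT. Qed.

Lemma clip_max (r : R) : 0 < r -> forall x, 0 < x -> 0 < Num.max r x <= x + r.
Proof.
by move=> r0 x x0; rewrite lt_max r0 ge_max lerDl lerDr (ltW r0) (ltW x0).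
Qed.

Lemma near_min (f : nat -> R) (a r : R) : f n @[n --> \oo] --> a -> a < r ->
  \forall n \near \oo, Num.min r (f n) = f n.
Proof.
move=> fa ar; have /(_ _) := cvgr_lt _ fa _ ar.
by apply: filterS => n /ltW/min_r.
Qed.

Lemma near_max (f : nat -> R) (a r : R) : f n @[n --> \oo] --> a -> r < a ->
  \forall n \near \oo, Num.max r (f n) = f n.
Proof.
move=> fa ar; have /(_ _) := cvgr_gt _ fa _ ar.
by apply: filterS => n /ltW/max_r.
Qed.

Lemma tilt_cvg_pos e w a : w n%:Z @[n --> \oo] --> a ->
  tilt e w n%:Z @[n --> \oo] --> (1 - e) * a.
Proof. by move=> wa; apply: cvgMr wa. Qed.

Lemma tilt_cvg_neg e w a : w (- n%:Z) @[n --> \oo] --> a ->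
  tilt e w (- n%:Z) @[n --> \oo] --> (1 + e) * a.
Proof.
move=> wa.
have : (1 + e) * w (- n%:Z) @[n --> \oo] --> (1 + e) * a by apply: cvgMr wa.
apply: cvg_trans; apply: near_eq_cvg.
(* At n = 0 the index - n falls in the nonnegative half. *)
by exists 1%N => // -[].
Qed.

End forward_shift_spectrum.

(** * The spectrum *)

Section forward_shift_annulus.
Context {R : realType} {p : R} {p1 : 1 <= p}.
Local Notation normc := Normc.normc.
Local Notation shift wb := (@forward_shift R p p1 _ wb).
Local Notation "T ~- l" := (T \- l \*: idfun : {linear lp p1 -> lp p1})
  (at level 50).
Variables (w : int -> R) (wb : bounded_fun w) (w_gt0 : forall n, 0 < w n).
Variables (w_plus w_minus : R).
Hypotheses (w_cvg_plus : w n%:Z @[n --> \oo] --> w_plus)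
  (w_cvg_minus : w (- n%:Z) @[n --> \oo] --> w_minus).

Lemma limits_ge c : (forall n, c <= w n) -> c <= Num.min w_minus w_plus.
Proof.
move=> cw; rewrite le_min; apply/andP; split.
  by apply: (cvgr_to_ge w_cvg_minus); near=> n.
by apply: (cvgr_to_ge w_cvg_plus); near=> n.
Unshelve. all: by end_near. Qed.

(** For max < r < |l|, clipping makes all weights at most r. *)
Lemma invertible_shift_outside l : Num.max w_minus w_plus < normc l ->
  invertible_op (shift wb ~- l).
Proof.
move=> Ml; pose r := (Num.max w_minus w_plus + normc l) / 2.
have M0 : 0 <= Num.max w_minus w_plus.
  rewrite le_max; have := @limits_ge 0 (fun n => ltW (w_gt0 n)).
  by rewrite le_min => /andP[->].
have [r0 Mr rl] : [/\ 0 < r, Num.max w_minus w_plus < r & r < normc l].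
  by rewrite /r; split; lra.
move: Mr; rewrite gt_max => /andP[mr pr].
have [ub ubP] := invertible_shift_clip (p1 := p1) wb w_gt0
  (clip_min r0) (clip_min r0)
  (near_min w_cvg_plus pr) (near_min w_cvg_minus mr).
apply/ubP; apply: (@invertible_shift_small _ _ _ _ _ r) => // n.
by case: n => n /=; rewrite lt_min r0 w_gt0 ge_min lexx.
Qed.

(** For |l| < r < min, clipping makes all weights at least r. *)
Lemma invertible_shift_inside l : normc l < Num.min w_minus w_plus ->
  invertible_op (shift wb ~- l).
Proof.
move=> lm; pose r := (Num.min w_minus w_plus + normc l) / 2.
have [r0 rm lr] : [/\ 0 < r, r < Num.min w_minus w_plus & normc l < r].
  by have := normc_ge0 l; rewrite /r; split; lra.
move: rm; rewrite lt_min => /andP[mr pr].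
have [ub ubP] := invertible_shift_clip (p1 := p1) wb w_gt0
  (clip_max r0) (clip_max r0)
  (near_max w_cvg_plus pr) (near_max w_cvg_minus mr).
apply/ubP; apply: (@invertible_shift_large _ _ _ _ _ r) => // n.
by case: n => n /=; rewrite le_max lexx.
Qed.

(** An inverse would persist under a slight tilt, which puts the limits of the
    weights strictly on opposite sides of |l|: below |l| at +oo and above it at
    -oo there is an eigenvector, and in the opposite configuration a functional
    vanishing on the range. *)
Lemma not_invertible_shift_annulus l :
  Num.min w_minus w_plus <= normc l <= Num.max w_minus w_plus ->
  ~ invertible_op (shift wb ~- l).
Proof.
have [->|l0 lP] := eqVneq l 0.
  rewrite Normc.normc0 => /andP[m0 _] /(invertible_shift_lb w_gt0)[c c0].
  by move=> /limits_ge/(lt_le_trans c0)/lt_le_trans/(_ m0); rewrite ltxx.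
have nl0 : 0 < normc l by rewrite normc_gt0.
move=> /invertible_shift_tilt[e /andP[e0 e1] tiltP].
have tilt_gt0 e' n : `|e'| <= e -> 0 < tilt e' w n.
  rewrite ler_norml => /andP[? ?].
  by case: n => n /=; rewrite mulr_gt0//; lra.
have tilt_bounded e' : `|e'| <= e -> bounded_fun (tilt e' w).
  move=> e'e; have [M wM] := (bounded_funP _).1 wb.
  apply/bounded_funP; exists (2 * M) => n; rewrite gtr0_norm ?tilt_gt0//.
  have := le_trans (ler_norm _) (wM n); have := w_gt0 n.
  move: e'e; rewrite ler_norml => /andP[? ?].
  by case: n => n /= wn0 wnM; apply: ler_pM => //; lra.
(* The tilt by e leaves room to clip at (1 - t) |l| and (1 + t) |l|; the common
   ratio q = 1 / (1 + t) suits both since (1 - t) (1 + t) <= 1. *)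
pose t := e / 2; have [t0 t1 te] : [/\ 0 < t, t < 1 & t < e].
  by rewrite /t; split; lra.
pose q := (1 + t)^-1.
have q01 : 0 < q < 1 by rewrite invr_gt0 invf_lt1; lra.
have /andP[q0 _] := q01.
pose r := (1 - t) * normc l; pose r' := (1 + t) * normc l.
have r0 : 0 < r by rewrite mulr_gt0// subr_gt0.
have r'0 : 0 < r' by rewrite mulr_gt0// addr_gt0.
have rq : r <= q * normc l.
  by rewrite ler_wpM2r ?(ltW nl0)// /q -[leRHS]div1r ler_pdivlMr; nra.
have qr' : normc l <= q * r' by rewrite /q /r' mulKf// gt_eqF// addr_gt0.
have below a : a <= normc l -> (1 - e) * a < r by rewrite /r; nra.
have above a : normc l <= a -> r' < (1 + e) * a by rewrite /r'; nra.
have [plus_minus|minus_plus] := leP w_plus w_minus.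
  move: lP; rewrite min_r// max_l// => /andP[pl lm].
  have ee : `|e| <= e by rewrite ger0_norm ?(ltW e0).
  have vb := tilt_bounded _ ee.
  have [ub ubP] := invertible_shift_clip (p1 := p1) vb
    (fun n => tilt_gt0 _ n ee) (clip_min r0) (clip_max r'0)
    (near_min (tilt_cvg_pos w_cvg_plus) (below _ pl))
    (near_max (tilt_cvg_neg w_cvg_minus) (above _ lm)).
  move: (tiltP _ vb ee) => /ubP.
  apply: (@not_invertible_shift_eigenvector _ _ _ _ _ q) => // [[n|n]|n|n] /=.
  - by rewrite lt_min r0 (tilt_gt0 _ (Posz n)).
  - by rewrite lt_max r'0.
  - by rewrite ge_min rq.
  - by apply: le_trans qr' _; rewrite ler_wpM2l ?le_max ?lexx// ltW.
move: lP; rewrite (min_l (ltW minus_plus)) (max_r (ltW minus_plus)).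
move=> /andP[ml lp].
have ee : `|- e| <= e by rewrite normrN ger0_norm ?(ltW e0).
have vb := tilt_bounded _ ee.
have := tilt_cvg_pos (e := - e) w_cvg_plus; rewrite opprK => vp.
have vm := tilt_cvg_neg (e := - e) w_cvg_minus.
have [ub ubP] := invertible_shift_clip (p1 := p1) vb
  (fun n => tilt_gt0 _ n ee) (clip_max r'0) (clip_min r0)
  (near_max vp (above _ lp)) (near_min vm (below _ ml)).
move: (tiltP _ vb ee) => /ubP.
apply: (@not_invertible_shift_functional _ _ _ _ _ q) => // [[n|n]|n|n] /=.
- by rewrite lt_max r'0.
- by rewrite lt_min r0 (tilt_gt0 _ (Negz n)).
- by apply: le_trans qr' _; rewrite ler_wpM2l ?le_max ?lexx// ltW.
- by rewrite ge_min rq.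
Qed.

Lemma invertible_shiftP l : invertible_op (shift wb ~- l) <->
  ~~ (Num.min w_minus w_plus <= normc l <= Num.max w_minus w_plus).
Proof.
split; first by move=> inv; apply/negP => /not_invertible_shift_annulus; apply.
rewrite negb_and -!ltNge => /orP[].
  exact: invertible_shift_inside.
exact: invertible_shift_outside.
Qed.

End forward_shift_annulus.

Section backward_shift.
Context {R : realType} {p : R} {p1 : 1 <= p}.
Local Notation "T ~- l" := (T \- l \*: idfun : {linear lp p1 -> lp p1})
  (at level 50).

(** The reflection of Z conjugates the backward shift to a forward shift. *)
Lemma invertible_backward_shift (w : int -> R) (wb : bounded_fun w)
    (vb : bounded_fun (fun n => w (- n))) (l : R[i]) :
  invertible_op (backward_shift wb ~- l) <->
  invertible_op (forward_shift vb ~- l).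
Proof.
have one_bounded : bounded_fun (fun _ : int => 1 : R).
  by apply/bounded_funP; exists 1 => n; rewrite normr1.
pose J : {linear lp p1 -> lp p1} := weighted_comp one_bounded (@oppr_inj int).
have Jb : bounded_op J by exact: weighted_comp_bounded.
have JE x n : J x n = x (- n) by rewrite /= /weighted_comp_fun mul1r.
have JK : cancel J J by move=> x; apply: lp_ext => n; rewrite !JE opprK.
have FJ x : (forward_shift vb ~- l) (J x) = J ((backward_shift wb ~- l) x).
  apply: lp_ext => n; rewrite JE shift_sub_coord !JE.
  rewrite -[RHS]/((w (- n + 1))%:C * x (- n + 1) - l * x (- n)).
  by have -> : - (n - 1) = - n + 1 by rewrite opprB addrC.
split; last exact: (@invertible_op_conj _ _ _ _ J J).
apply: (@invertible_op_conj _ _ _ _ J J) => // x.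
by rewrite -[LHS]JK -FJ JK.
Qed.

End backward_shift.

Theorem proposition3p2p2 (R : realType) (p : R) (p1 : 1 <= p)
  (w : int -> R) (wb : bounded_fun w) (w_gt0 : forall n, 0 < w n)
  (w_plus w_minus : R)
  (w_cvg_plus : w n%:Z @[n --> \oo] --> w_plus)
  (w_cvg_minus : w (- n%:Z) @[n --> \oo] --> w_minus)
  (T : lp p1 -> lp p1)
  (T_shift : T = forward_shift wb \/ T = backward_shift wb) :
  (invertible_op T ->
    spectrum T =
      [set l : R[i] | (Num.min w_minus w_plus)%:C <= `|l|
                        <= (Num.max w_minus w_plus)%:C]) /\
  (~ invertible_op T ->
    spectrum T = [set l : R[i] | `|l| <= (Num.max w_minus w_plus)%:C]).
Proof.
have invP l : invertible_op (T \- l \*: idfun) <->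
    ~~ (Num.min w_minus w_plus <= Normc.normc l <= Num.max w_minus w_plus).
  case: T_shift => ->; first exact: invertible_shiftP.
  have vb : bounded_fun (fun n => w (- n)).
    have [M wM] := (bounded_funP _).1 wb.
    by apply/bounded_funP; exists M.
  rewrite (invertible_backward_shift wb vb) minC maxC.
  apply: invertible_shiftP => //.
  by under eq_fun do rewrite opprK.
have spectrumE : spectrum T =
    [set l : R[i] | (Num.min w_minus w_plus)%:C <= `|l|
                      <= (Num.max w_minus w_plus)%:C].
  apply/seteqP; split=> l;
    rewrite /spectrum/= -[`|l|]/((Normc.normc l)%:C) !lecR.
    by move=> Tl; apply: contrapT => lP; apply: Tl; apply/invP; apply/negP.
  by move=> lP /invP; rewrite lP.
split=> // nT; rewrite spectrumE.
have T0 : T \- 0 \*: idfun = T.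
  by apply/funext => x /=; rewrite scale0r subr0.
(* The inner disc is empty, since 0 would otherwise be a regular value. *)
have m0 : Num.min w_minus w_plus <= 0.
  rewrite leNgt; apply/negP => m0; apply: nT; rewrite -T0; apply/invP.
  by rewrite Normc.normc0 negb_and -ltNge m0.
apply/seteqP; split=> l /=; first by case/andP.
move=> ->; rewrite andbT -[`|l|]/((Normc.normc l)%:C) lecR.
exact: le_trans m0 (normc_ge0 _).
Qed.
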